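(* Let $A\in\mathbb{H}^{m\times n}$, $B_1\in\mathbb{H}^{m\times k}$, $C_2\in\mathbb{H}^{l\times n}$, $B_3\in\mathbb{H}^{m\times k_3}$, $C_3\in\mathbb{H}^{l_3\times n}$, $B_4\in\mathbb{H}^{m\times k_4}$, $C_4\in\mathbb{H}^{l_4\times n}$ be given, and let $$f_2(X_1,X_2,X_3,X_4)=A-B_1X_1-X_2C_2-B_3X_3C_3-B_4X_4C_4,$$ where $X_1\in\mathbb{H}^{k\times n}$, $X_2\in\mathbb{H}^{m\times l}$, $X_3\in\mathbb{H}^{k_3\times l_3}$, $X_4\in\mathbb{H}^{k_4\times l_4}$ are variable. Then $$\max_{\{X_i\}} r[f_2(X_1,X_2,X_3,X_4)]=\min\left\{m,\ n,\ r\begin{bmatrix}A&B_1\\C_2&0\\C_3&0\\C_4&0\end{bmatrix},\ r\begin{bmatrix}A&B_1&B_3&B_4\\C_2&0&0&0\end{bmatrix},\ r\begin{bmatrix}A&B_1&B_3\\C_2&0&0\\C_4&0&0\end{bmatrix},\ r\begin{bmatrix}A&B_1&B_4\\C_2&0&0\\C_3&0&0\end{bmatrix}\right\},$$ $$\min_{\{X_i\}} r[f_2(X_1,X_2,X_3,X_4)]=r\begin{bmatrix}A&B_1\\C_2&0\\C_3&0\\C_4&0\end{bmatrix}+r\begin{bmatrix}A&B_1&B_3&B_4\\C_2&0&0&0\end{bmatrix}-r(B_1)-r(C_2)+\max\{s_1,s_2\},$$ where $$s_1=r\begin{bmatrix}A&B_1&B_3\\C_2&0&0\\C_4&0&0\end{bmatrix}-r\begin{bmatrix}A&B_1&B_3&B_4\\C_2&0&0&0\\C_4&0&0&0\end{bmatrix}-r\begin{bmatrix}A&B_1&B_3\\C_2&0&0\\C_3&0&0\\C_4&0&0\end{bmatrix},$$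 $$s_2=r\begin{bmatrix}A&B_1&B_4\\C_2&0&0\\C_3&0&0\end{bmatrix}-r\begin{bmatrix}A&B_1&B_3&B_4\\C_2&0&0&0\\C_3&0&0&0\end{bmatrix}-r\begin{bmatrix}A&B_1&B_4\\C_2&0&0\\C_3&0&0\\C_4&0&0\end{bmatrix}.$$
   Context: $\mathbb{H}$ is the real quaternion algebra and $\mathbb{H}^{m\times n}$ is the set of $m\times n$ matrices over $\mathbb{H}$. The rank $r(M)$ of a quaternion matrix $M$ is the dimension of its column right space (equivalently, of its row left space). The maximum and minimum are over all quaternion matrices $X_1,X_2,X_3,X_4$ of the indicated sizes. *)

(* Defs.v *)
From HB Require Import structures.
From mathcomp Require Import all_boot all_order all_algebra.
From mathcomp Require Import ring.
From mathcomp Require Import boolp classical_sets reals.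

Set Implicit Arguments.
Unset Strict Implicit.
Unset Printing Implicit Defensive.

Import Order.TTheory GRing.Theory Num.Theory.
Local Open Scope classical_set_scope.
Local Open Scope ring_scope.

(** [Quat a b c d] stands for a + b i + c j + d k, with
    i^2 = j^2 = k^2 = ijk = -1. *)

Record quaternion (R : Type) := Quat { qre : R; qi : R; qj : R; qk : R }.

Definition quat_tuple R (x : quaternion R) : R * R * R * R :=
  (qre x, qi x, qj x, qk x).
Definition tuple_quat R (t : R * R * R * R) : quaternion R :=
  Quat t.1.1.1 t.1.1.2 t.1.2 t.2.
Lemma quat_tupleK R : cancel (@quat_tuple R) (@tuple_quat R).
Proof. by case. Qed.

HB.instance Definition _ (R : eqType) :=
  Equality.copy (quaternion R) (can_type (@quat_tupleK R)).
HB.instance Definition _ (R : choiceType) :=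
  Choice.copy (quaternion R) (can_type (@quat_tupleK R)).

Section QuaternionRing.
Variable R : realType.
Implicit Types x y z : quaternion R.

Definition addq x y :=
  Quat (qre x + qre y) (qi x + qi y) (qj x + qj y) (qk x + qk y).
Definition oppq x := Quat (- qre x) (- qi x) (- qj x) (- qk x).
Definition mulq x y :=
  let: Quat a b c d := x in
  let: Quat a' b' c' d' := y in
  Quat (a * a' - b * b' - c * c' - d * d')
       (a * b' + b * a' + c * d' - d * c')
       (a * c' - b * d' + c * a' + d * b')
       (a * d' + b * c' - c * b' + d * a').

Lemma addqA : associative addq.
Proof. by move=> x y z; congr Quat; rewrite /= addrA. Qed.
Lemma addqC : commutative addq.
Proof. by move=> x y; congr Quat; rewrite addrC. Qed.
Lemma add0q : left_id (Quat 0 0 0 0) addq.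
Proof. by case=> a b c d; rewrite /addq /= !add0r. Qed.
Lemma addNq : left_inverse (Quat 0 0 0 0) oppq addq.
Proof. by case=> a b c d; rewrite /addq /= !addNr. Qed.
HB.instance Definition _ :=
  GRing.isZmodule.Build (quaternion R) addqA addqC add0q addNq.

Lemma mulqA : associative mulq.
Proof.
by move=> [a b c d] [a' b' c' d'] [a'' b'' c'' d'']; congr Quat; rewrite /=; ring.
Qed.
Lemma mul1q : left_id (Quat 1 0 0 0) mulq.
Proof. by case=> a b c d; congr Quat; rewrite /=; ring. Qed.
Lemma mulq1 : right_id (Quat 1 0 0 0) mulq.
Proof. by case=> a b c d; congr Quat; rewrite /=; ring. Qed.
Lemma mulqDl : left_distributive mulq addq.
Proof.
by move=> [a b c d] [a' b' c' d'] [a'' b'' c'' d'']; congr Quat; rewrite /=; ring.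
Qed.
Lemma mulqDr : right_distributive mulq addq.
Proof.
by move=> [a b c d] [a' b' c' d'] [a'' b'' c'' d'']; congr Quat; rewrite /=; ring.
Qed.
Lemma oneq_neq0 : Quat 1 0 0 0 != 0 :> quaternion R.
Proof. by apply/eqP => -[/eqP]; rewrite oner_eq0. Qed.
HB.instance Definition _ := GRing.Zmodule_isNzRing.Build (quaternion R)
  mulqA mul1q mulq1 mulqDl mulqDr oneq_neq0.

Definition invq x :=
  let: Quat a b c d := x in
  let n := a ^+ 2 + b ^+ 2 + c ^+ 2 + d ^+ 2 in
  Quat (a / n) (- (b / n)) (- (c / n)) (- (d / n)).

Lemma normq_neq0 (a b c d : R) :
  Quat a b c d != 0 -> a ^+ 2 + b ^+ 2 + c ^+ 2 + d ^+ 2 != 0.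
Proof.
apply: contra; rewrite !paddr_eq0 ?addr_ge0 ?sqr_ge0 // !sqrf_eq0.
by case/andP => /andP[/andP[/eqP-> /eqP->] /eqP->] /eqP->.
Qed.
Lemma mulVq : {in [pred x | x != 0], left_inverse 1 invq *%R}.
Proof.
move=> [a b c d] /normq_neq0 n0.
by rewrite /invq; congr Quat; field.
Qed.
Lemma mulqV : {in [pred x | x != 0], right_inverse 1 invq *%R}.
Proof.
move=> [a b c d] /normq_neq0 n0.
by rewrite /invq; congr Quat; field.
Qed.
Lemma unitqP x y : y * x = 1 /\ x * y = 1 -> [pred x | x != 0] x.
Proof.
case=> xy1 _; apply/eqP => x0; move/eqP: xy1.
by rewrite x0 mulr0 eq_sym oner_eq0.
Qed.
Lemma invq_out : {in [predC [pred x | x != 0]], invq =1 id}.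
Proof.
move=> x; rewrite !inE negbK => /eqP ->.
by rewrite /invq /= !mul0r oppr0.
Qed.
HB.instance Definition _ := GRing.NzRing_hasMulInverse.Build (quaternion R)
  mulVq mulqV unitqP invq_out.

Lemma unitqE x : (x \is a GRing.unit) = (x != 0). Proof. by []. Qed.

End QuaternionRing.

(** Scalars act on columns from the right: the right linear combinations of the
    columns of [M] are the products [M *m x]. *)

Section RightRank.
Variable R : realType.
Local Notation H := (quaternion R).

Definition right_colspace m n (M : 'M[H]_(m, n)) : set 'cV[H]_m :=
  [set M *m x | x in [set: 'cV[H]_n]].

Definition right_free m n (M : 'M[H]_(m, n)) : Prop :=
  forall x : 'cV[H]_n, M *m x = 0 -> x = 0.

(** The columns of [P] form a basis of the right subspace [V] of H^m. *)
Definition right_basis m k (V : set 'cV[H]_m) (P : 'M[H]_(m, k)) : Prop :=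
  right_free P /\ right_colspace P = V.

(** The number of elements of a basis of [V]; for column spaces it exists and is
    unique by [qrank_basis] and [right_basis_qrank] below. *)
Definition right_dim m (V : set 'cV[H]_m) : nat :=
  xget 0%N [set k | exists P : 'M[H]_(m, k), right_basis V P].

Definition qrank m n (M : 'M[H]_(m, n)) : nat := right_dim (right_colspace M).

Lemma wide_not_free l k (Y : 'M[H]_(l, k)) :
  (l < k)%N -> exists2 x : 'cV[H]_k, x != 0 & Y *m x = 0.
Proof.
elim: l k Y => [|l IH] [|k] Y // lk.
  exists (const_mx 1); last by apply/matrixP => -[].
  by apply/eqP => /matrixP /(_ ord0 ord0) /eqP; rewrite !mxE oner_eq0.
have [j Yj|Y0] := pickP (fun j => Y ord0 j != 0); last first.
  have [x x0 Yx] := IH _ (row' ord0 Y) (ltnW lk).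
  exists x => //; apply/matrixP => i q; rewrite !mxE.
  case: (unliftP ord0 i) => [i' ->|->].
    move/matrixP/(_ i' q): Yx; rewrite !mxE => Yxi; rewrite -[RHS]Yxi.
    by apply: eq_bigr => p _; rewrite mxE.
  by rewrite big1 // => p _; rewrite (eqP (negbFE (Y0 p))) mul0r.
pose a := Y ord0 j.
pose Y' := \matrix_(i < l, p < k)
  (Y (lift ord0 i) (lift j p) - Y (lift ord0 i) j * a^-1 * Y ord0 (lift j p)).
have [x' x'0 Yx'] := IH k Y' lk.
pose s := \sum_p Y ord0 (lift j p) * x' p ord0.
pose x : 'cV[H]_k.+1 :=
  \col_p if unlift j p is Some p' then x' p' ord0 else - (a^-1 * s).
have xl p : x (lift j p) ord0 = x' p ord0 by rewrite mxE liftK.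
have xj : x j ord0 = - (a^-1 * s) by rewrite mxE unlift_none.
exists x.
  apply: contra x'0 => /eqP x0; apply/eqP/matrixP => p q.
  by rewrite (ord1 q) -xl x0 !mxE.
apply/matrixP => i q; rewrite (ord1 q) !mxE (bigD1_ord j) //= xj.
under eq_bigr => p _ do rewrite xl.
case: (unliftP ord0 i) => [i' ->|->]; last first.
  by rewrite -/s mulrN mulrA -/a mulrV ?unitqE // mul1r addNr.
move/matrixP/(_ i' ord0): Yx'; rewrite !mxE => Yxi; rewrite -[RHS]Yxi.
under [RHS]eq_bigr => p _ do rewrite mxE mulrBl -[_ * _ * _ * _]mulrA.
by rewrite sumrB -mulr_sumr -/s addrC mulrN mulrA.
Qed.

Lemma right_free_leq m k l (P : 'M[H]_(m, k)) (Q : 'M[H]_(m, l)) :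
  right_free P -> right_colspace P `<=` right_colspace Q -> (k <= l)%N.
Proof.
move=> freeP sPQ; rewrite leqNgt; apply/negP => lk.
have /choice[y Qy] (j : 'I_k) : exists y : 'cV[H]_l, Q *m y = col j P.
  have [|y _ <-] := sPQ (col j P); last by exists y.
  by exists (delta_mx j ord0) => //; rewrite colE.
have PE : P = Q *m (\matrix_(i, j) y j i ord0).
  apply/matrixP => i j; move/matrixP/(_ i ord0): (Qy j); rewrite !mxE => <-.
  by apply: eq_bigr => p _; rewrite mxE.
have [x /eqP x0 Yx] := wide_not_free (\matrix_(i, j) y j i ord0) lk.
by apply: x0; apply: freeP; rewrite PE -mulmxA Yx mulmx0.
Qed.

Lemma right_basis_exists m n (M : 'M[H]_(m, n)) :
  exists k (P : 'M[H]_(m, k)), right_basis (right_colspace M) P.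
Proof.
pose sp k := `[< exists P : 'M[H]_(m, k), right_colspace P = right_colspace M >].
have ex_sp : exists k, sp k by exists n; apply/asboolP; exists M.
case: (ex_minnP ex_sp) => k /asboolP[P PM] mink; exists k, P; split=> // x Px.
apply: contrapT => /eqP x0; case: k P PM mink x Px x0 => [|k] P PM mink x Px x0.
  by case/eqP: x0; apply/matrixP => -[].
have [j xj|x0'] := pickP (fun j => x j ord0 != 0); last first.
  case/eqP: x0; apply/matrixP => i q; rewrite (ord1 q) mxE.
  exact/eqP/negbFE/x0'.
suff /mink : sp k by rewrite ltnn.
apply/asboolP; exists (col' j P); rewrite -PM; apply/seteqP; split=> v [z _ <-].
  exists (\col_p if unlift j p is Some p' then z p' ord0 else 0) => //.
  apply/matrixP => i q; rewrite (ord1 q) !mxE (bigD1_ord j) //=.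
  rewrite mxE unlift_none mulr0 add0r.
  by apply: eq_bigr => p _; rewrite !mxE liftK.
pose w : 'cV[H]_k.+1 := z - x *m ((x j ord0)^-1 * z j ord0)%:M.
have wj : w j ord0 = 0.
  by rewrite !mxE big_ord1 !mxE eqxx mulrA mulrV ?unitqE // mul1r subrr.
have -> : P *m z = P *m w by rewrite mulmxBr mulmxA Px mul0mx subr0.
exists (\col_p w (lift j p) ord0) => //.
apply/matrixP => i q; rewrite (ord1 q) !mxE [RHS](bigD1_ord j) //=.
by rewrite wj mulr0 add0r; apply: eq_bigr => p _; rewrite !mxE.
Qed.

Lemma qrank_basis m n (M : 'M[H]_(m, n)) :
  exists P : 'M[H]_(m, qrank M), right_basis (right_colspace M) P.
Proof.
have [k exP] := right_basis_exists M.
rewrite /qrank /right_dim; case: xgetP => [_ _ //|noP].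
by case: (noP k).
Qed.

Lemma right_basis_qrank m n k (M : 'M[H]_(m, n)) (P : 'M[H]_(m, k)) :
  right_basis (right_colspace M) P -> qrank M = k.
Proof.
have [Q [freeQ QM]] := qrank_basis M => -[freeP PM].
apply/eqP; rewrite eqn_leq; apply/andP; split.
  by apply: (right_free_leq freeQ (Q := P)); rewrite QM PM.
by apply: (right_free_leq freeP (Q := Q)); rewrite PM QM.
Qed.

End RightRank.

Definition is_maximum d (T : porderType d) (A : set T) (a : T) : Prop :=
  A a /\ ubound A a.

Definition is_minimum d (T : porderType d) (A : set T) (a : T) : Prop :=
  A a /\ lbound A a.

(* Main.v *)
(* A quaternion matrix factors through its rank, which gives generalized inverses
   and block rank inequalities as over a field.

   For fixed X3, X4, put M = A - B3 X3 C3 - B4 X4 C4. Over X1 and X2, the rank of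
   M - B1 X1 - X2 C2 has maximum min(m, n, r[M B1; C2 0]) and minimum
   r[M B1; C2 0] - r(B1) - r(C2). So bordering by B1 and C2 reduces the problem to
   X3 and X4 alone. Varying X3 and X4 changes no block rank in the formulas except
   r(M), so it suffices to improve every M that misses the bound.

   If r(M) is too small, some of the columns of B3, B4 and rows of C3, C4 lie
   outside the column and row spaces of M, and adding them raises the rank.

   If r(M) is too large, it exceeds each of the two bounds given by s1 and s2 by a
   sum of gaps r(M) + r[M B; C 0] - r[M B] - r[M; C] >= 0. A positive gap produces
   v and z with M v = B u, z M = e C and z M v = 1, hence Wedderburn's reduction
   M - (M v) (z M) = M - B u e C. Two such witnesses that share v (or z) combine
   into one pair of updates of X3 and X4 that lowers the rank. *)

Require Import Defs.
From HB Require Import structures.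
From mathcomp Require Import all_boot all_order all_algebra.
From mathcomp Require Import boolp classical_sets reals.
From mathcomp Require Import zify.

Set Implicit Arguments.
Unset Strict Implicit.
Unset Printing Implicit Defensive.

Import Order.TTheory GRing.Theory Num.Theory.
Local Open Scope classical_set_scope.
Local Open Scope ring_scope.

(** * Rank factorizations and generalized inverses *)

Section QuaternionRank.
Variable R : realType.
Local Notation H := (quaternion R).

Lemma mx_neq0 m n (M : 'M[H]_(m, n)) : M != 0 -> exists i j, M i j != 0.
Proof.
move=> M0; apply: contrapT => noij; case/eqP: M0; apply/matrixP => i j.
rewrite mxE; apply: contrapT => /eqP Mij; apply: noij; by exists i, j.
Qed.

Lemma mx_pairing m n (M : 'M[H]_(m, n)) : M != 0 ->
  exists (y : 'rV[H]_m) (x : 'cV[H]_n), y *m M *m x = 1%:M.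
Proof.
case/mx_neq0 => i [j Mij].
exists ((M i j)^-1 *: delta_mx 0 i), (delta_mx j 0).
rewrite -scalemxAl -rowE -colE; apply/matrixP => p q.
by rewrite !mxE !ord1 eqxx /= mulVr ?unitqE.
Qed.

Lemma mx11_inv (a : 'M[H]_1) : a != 0 ->
  exists2 b : 'M[H]_1, b *m a = 1%:M & a *m b = 1%:M.
Proof.
move=> a0; have a00 : a 0 0 != 0.
  by apply: contra a0 => /eqP a00; apply/eqP/matrixP => i j; rewrite !ord1 mxE.
exists (a 0 0)^-1%:M; rewrite [a]mx11_scalar -scalar_mxM.
  by rewrite mxE eqxx mulr1n mulVr ?unitqE.
by rewrite mxE eqxx mulr1n mulrV ?unitqE.
Qed.

(** Induction on the columns. With [P = [p P2]] and [P2'] a left inverse of [P2], freeness keeps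
    [1 - P2 P2'] from killing [p], which yields a row [z] with [z P2 = 0] and [z p = 1]. *)
Lemma right_free_linv m k (P : 'M[H]_(m, k)) :
  right_free P -> exists P' : 'M[H]_(k, m), P' *m P = 1%:M.
Proof.
elim: k P => [|k IH] P freeP.
  by exists 0; apply/matrixP => -[].
pose p : 'cV[H]_m := lsubmx (P : 'M_(m, 1 + k)).
pose P2 : 'M[H]_(m, k) := rsubmx (P : 'M_(m, 1 + k)).
have PE : P = row_mx p P2 by rewrite hsubmxK.
have PM (x : 'M[H]_1) (y : 'cV[H]_k) :
    P *m (col_mx x y : 'cV_(1 + k)) = p *m x + P2 *m y.
  by rewrite {1}PE; exact: (@mul_row_col _ m 1 k 1 p P2 x y).
have [|P2' P2'K] := IH P2.
  move=> x P2x; have /freeP : P *m (col_mx 0 x : 'cV_(1 + k)) = 0.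
    by rewrite PM P2x mulmx0 addr0.
  by move=> x0; rewrite -(col_mxKd (0 : 'cV[H]_1) x) x0 linear0.
have p1 : (1%:M - P2 *m P2') *m p != 0.
  apply/eqP; rewrite mulmxBl mul1mx -mulmxA => /eqP.
  rewrite subr_eq0 => /eqP pE.
  have /freeP : P *m (col_mx 1%:M (- (P2' *m p)) : 'cV_(1 + k)) = 0.
    by rewrite PM mulmx1 mulmxN -pE subrr.
  move/(congr1 (fun x => usubmx (x : 'cV_(1 + k)))); rewrite col_mxKu.
  by move/matrixP/(_ 0 0)/eqP; rewrite !mxE eqxx oner_eq0.
have [y [x yx]] := mx_pairing p1.
(* Here [x] is an invertible 1 by 1 matrix, so [y N x = 1] with [N = (1 - P2 P2') p] turns into
   [x y N = 1]. *)
pose z := x *m y *m (1%:M - P2 *m P2').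
have zP2 : z *m P2 = 0.
  by rewrite -mulmxA mulmxBl mul1mx -(mulmxA P2) P2'K mulmx1 subrr mulmx0.
have zp : z *m p = 1%:M.
  have x0 : x != 0.
    apply/eqP => x0; move/matrixP/(_ 0 0)/eqP: yx.
    by rewrite x0 mulmx0 !mxE eqxx eq_sym oner_eq0.
  have [b bx xb] := mx11_inv x0.
  rewrite /z -!mulmxA -xb; congr (x *m _).
  by rewrite -[LHS]mulmx1 -xb mulmxA yx mul1mx.
(* Subtracting [P2' p z] makes the lower block kill [p] without changing its product with [P2]. *)
exists (col_mx z (P2' - P2' *m p *m z)).
rewrite [in LHS]PE (@mul_col_row _ 1 k m 1 k).
have E N (Z : 'M[H]_(m, N)) :
    (P2' - P2' *m p *m z) *m Z = P2' *m Z - P2' *m p *m (z *m Z).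
  by rewrite mulmxBl !mulmxA.
rewrite !E zp zP2 P2'K mulmx0 mulmx1 subrr subr0.
exact/esym/(scalar_mx_block 1 k 1).
Qed.

Lemma right_colspace_sub m k l (P : 'M[H]_(m, k)) (Q : 'M[H]_(m, l)) :
  right_colspace P `<=` right_colspace Q -> exists Y, P = Q *m Y.
Proof.
move=> sPQ.
have /choice[y Qy] (j : 'I_k) : exists y : 'cV[H]_l, Q *m y = col j P.
  have [|y _ <-] := sPQ (col j P); last by exists y.
  by exists (delta_mx j ord0) => //; rewrite colE.
exists (\matrix_(i, j) y j i ord0).
apply/matrixP => i j; move/matrixP/(_ i ord0): (Qy j); rewrite !mxE => <-.
by apply: eq_bigr => p _; rewrite mxE.
Qed.

(** The columns of [P] are a basis of the column space of [M]. The rank is returned as a variable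
    [r], so that [M] can be rewritten without disturbing the types of the factors. *)
Lemma qrank_factor m n (M : 'M[H]_(m, n)) :
  exists r (P : 'M[H]_(m, r)) (Q : 'M[H]_(r, n)) P' Q',
    [/\ qrank M = r, M = P *m Q, P' *m P = 1%:M & Q *m Q' = 1%:M].
Proof.
have [P [freeP PM]] := qrank_basis M.
have [P' P'K] := right_free_linv freeP.
have [|Q MQ] := @right_colspace_sub _ _ _ M P; first by rewrite PM.
have [|Y PY] := @right_colspace_sub _ _ _ P M; first by rewrite PM.
exists (qrank M), P, Q, P', Y; split => //.
by rewrite -[LHS]mul1mx -P'K -!mulmxA (mulmxA P) -MQ -PY.
Qed.

Lemma qrank_mul_le m k n (P : 'M[H]_(m, k)) (Q : 'M[H]_(k, n)) :
  (qrank (P *m Q) <= k)%N.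
Proof.
have [S [freeS SE]] := qrank_basis (P *m Q).
apply: (right_free_leq freeS (Q := P)); rewrite SE => _ [x _ <-].
by exists (Q *m x); rewrite // mulmxA.
Qed.

(** Explicit multipliers certify lower bounds: the identity of size [k] factors through the rank of
    [M]. *)
Lemma qrank_ge m n k (M : 'M[H]_(m, n)) (S : 'M[H]_(k, m)) T :
  S *m M *m T = 1%:M -> (k <= qrank M)%N.
Proof.
have [r [P [Q [_ [_ [-> -> _ _]]]]]] := qrank_factor M => E.
apply: (@right_free_leq _ k k _ 1%:M (S *m P)) => [x|_ [x _ <-]].
  by rewrite mul1mx.
by exists (Q *m T *m x); rewrite // -E !mulmxA.
Qed.

Lemma qrankMl p m n (L : 'M[H]_(p, m)) (M : 'M[H]_(m, n)) :
  (qrank (L *m M) <= qrank M)%N.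
Proof.
have [r [P [Q [_ [_ [-> -> _ _]]]]]] := qrank_factor M.
by rewrite mulmxA qrank_mul_le.
Qed.

Lemma qrankMr m n p (M : 'M[H]_(m, n)) (U : 'M[H]_(n, p)) :
  (qrank (M *m U) <= qrank M)%N.
Proof.
have [r [P [Q [_ [_ [-> -> _ _]]]]]] := qrank_factor M.
by rewrite -mulmxA qrank_mul_le.
Qed.

Lemma qrankMlr p m n q (L : 'M[H]_(p, m)) (M : 'M[H]_(m, n)) (U : 'M_(n, q)) :
  (qrank (L *m M *m U) <= qrank M)%N.
Proof. exact: leq_trans (qrankMr _ _) (qrankMl _ _). Qed.

Lemma qrankD m n (M N : 'M[H]_(m, n)) : (qrank (M + N) <= qrank M + qrank N)%N.
Proof.
have [r [P [Q [_ [_ [-> -> _ _]]]]]] := qrank_factor M.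
have [s [S [T [_ [_ [-> -> _ _]]]]]] := qrank_factor N.
by rewrite -mul_row_col qrank_mul_le.
Qed.

Lemma qrank_ublock_ge m n p q (M : 'M[H]_(m, n)) (D : 'M[H]_(m, q))
    (N : 'M[H]_(p, q)) :
  (qrank M + qrank N <= qrank (block_mx M D 0 N))%N.
Proof.
have [r [P [Q [P' [Q' [-> -> PK QK]]]]]] := qrank_factor M.
have [s [S [T [S' [T' [-> -> SK TK]]]]]] := qrank_factor N.
apply: (@qrank_ge _ _ _ _ (block_mx P' 0 0 S')
  (block_mx Q' (- (Q' *m P' *m D *m T')) 0 T')).
rewrite !mulmx_block !(mulmx0, mul0mx, addr0, add0r).
rewrite !mulmxA PK SK !mul1mx QK TK mulmxN !mulmxA QK mul1mx addNr.
exact/esym/scalar_mx_block.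
Qed.

Lemma ginv_exists m n (M : 'M[H]_(m, n)) :
  exists2 G : 'M[H]_(n, m), M *m G *m M = M & G *m M *m G = G.
Proof.
have [r [P [Q [P' [Q' [_ -> PK QK]]]]]] := qrank_factor M.
exists (Q' *m P').
  by rewrite !mulmxA -(mulmxA P) QK mulmx1 -(mulmxA P) PK mulmx1.
by rewrite !mulmxA -(mulmxA Q') PK mulmx1 -(mulmxA Q') QK mulmx1.
Qed.

Lemma qrank_castmx m n m' n' (e : (m = m') * (n = n')) (M : 'M[H]_(m, n)) :
  qrank (castmx e M) = qrank M.
Proof. by case: e => e1 e2; case: m' / e1; case: n' / e2. Qed.

End QuaternionRank.

(** * Block rank inequalities and the rank gap *)

Section RankGap.
Variable R : realType.
Local Notation H := (quaternion R).
Local Notation I := (1%:M : 'M[H]__).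
Local Notation O := (0 : 'M[H]_(_, _)).

(** A block triangular matrix with diagonal [[M; C]], [[M B]] and corner containing [[C D]] is the
    sum of a product through [M] and a product through [[M B; C D]]. With [D = 0] this says that
    rank gaps are nonnegative. *)
Lemma qrank_block_submod m n p q (M : 'M[H]_(m, n)) (B : 'M[H]_(m, q))
    (C : 'M[H]_(p, n)) (D : 'M[H]_(p, q)) :
  (qrank (row_mx M B) + qrank (col_mx M C)
     <= qrank M + qrank (block_mx M B C D))%N.
Proof.
rewrite addnC.
apply: leq_trans (qrank_ublock_ge _ (col_mx O (row_mx C D)) _) _.
suff -> : block_mx (col_mx M C) (col_mx O (row_mx C D)) 0 (row_mx M B) =
    (col_mx (col_mx I 0) (- 1%:M) *m M *m row_mx I 0)
    + (col_mx (col_mx O (row_mx O 1%:M)) (row_mx I 0)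
         *m block_mx M B C D *m row_mx (col_mx I 0) 1%:M).
  by apply: leq_trans (qrankD _ _) _; rewrite leq_add // qrankMlr.
have -> : col_mx (col_mx I 0) (- 1%:M) *m M *m row_mx I 0 =
    block_mx (col_mx M (0 : 'M_(p, n))) 0 (- M) (0 : 'M_(m, n + q)).
  by rewrite mul_mx_row mulmx1 mulmx0 !mul_col_mx mulNmx mul1mx mul0mx
    block_mxEh col_mx0.
have -> : col_mx (col_mx O (row_mx O 1%:M)) (row_mx I 0)
      *m block_mx M B C D *m row_mx (col_mx I 0) 1%:M =
    block_mx (col_mx (0 : 'M[H]_(m, n)) C) (col_mx O (row_mx C D))
      M (row_mx M B).
  rewrite mul_mx_row mulmx1 !mul_col_mx.
  rewrite !(mul0mx, mul1mx, mul_row_block, add0r, addr0).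
  by rewrite block_mxEh !(mul_row_col, mulmx0, mulmx1, addr0).
by rewrite add_block_mx !add_col_mx !addr0 !add0r addNr.
Qed.

(** [E = 1 - w y] is a projection killing [w]. Joining [y] and [w] to a rank factorization of [E]
    makes an identity of size [1 + r] factor through the identity of size [n]. *)
Lemma qrank_proj_lt n (y : 'rV[H]_n) (w : 'cV[H]_n) :
  y *m w = 1%:M -> (qrank (1%:M - w *m y) < n)%N.
Proof.
move=> yw; set E := 1%:M - _.
have yE : y *m E = 0 by rewrite mulmxBr mulmx1 mulmxA yw mul1mx subrr.
have Ew : E *m w = 0 by rewrite mulmxBl mul1mx -mulmxA yw mulmx1 subrr.
have EE : E *m E = E by rewrite {1}/E mulmxBl -mulmxA yE mulmx0 subr0 mul1mx.
have [r [P [Q [P' [Q' [-> EPQ PK QK]]]]]] := qrank_factor E.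
have EP : P = E *m Q' by rewrite EPQ -mulmxA QK mulmx1.
rewrite -(add1n r); apply: leq_trans (qrank_mul_le 1%:M 1%:M).
apply: (@qrank_ge _ _ _ _ _ (col_mx y (P' *m E)) (row_mx w P)).
have yP : y *m P = 0 by rewrite EP mulmxA yE mul0mx.
have EPP : E *m P = P by rewrite EP mulmxA EE.
rewrite !mulmx1 mul_col_row yw yP -!mulmxA Ew EPP mulmx0 PK.
exact/esym/scalar_mx_block.
Qed.

(** In a rank factorization [M = P Q], the product [T P] kills [Q v], so it absorbs a projection
    along [Q v], whose rank is below [r]. *)
Lemma qrankMl_lt p m n (T : 'M[H]_(p, m)) (M : 'M[H]_(m, n)) (v : 'cV[H]_n) :
  T *m M *m v = 0 -> M *m v != 0 -> (qrank (T *m M) < qrank M)%N.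
Proof.
have [r [P [Q [_ [_ [-> -> _ _]]]]]] := qrank_factor M => TMv Mv.
have [y [x yx]] : exists (y : 'rV_r) (x : 'M_1), y *m (Q *m v) *m x = 1%:M.
  by apply: mx_pairing; apply: contra Mv => /eqP E; rewrite -mulmxA E mulmx0.
rewrite -mulmxA in yx.
have := qrank_proj_lt yx; apply: leq_ltn_trans.
have -> : T *m (P *m Q) = T *m P *m (1%:M - Q *m v *m x *m y) *m Q.
  rewrite mulmxBr mulmx1 !mulmxA mulmxBl; rewrite !mulmxA in TMv.
  by rewrite TMv !mul0mx subr0.
exact: qrankMlr.
Qed.

Lemma qrankMr_lt p m n (M : 'M[H]_(m, n)) (T : 'M[H]_(n, p)) (y : 'rV[H]_m) :
  y *m (M *m T) = 0 -> y *m M != 0 -> (qrank (M *m T) < qrank M)%N.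
Proof.
have [r [P [Q [_ [_ [-> -> _ _]]]]]] := qrank_factor M => yMT yM.
have [z [x zx]] : exists (z : 'M_1) (x : 'cV_r), z *m (y *m P) *m x = 1%:M.
  by apply: mx_pairing; apply: contra yM => /eqP E; rewrite mulmxA E mul0mx.
have := qrank_proj_lt zx; apply: leq_ltn_trans.
have -> : P *m Q *m T = P *m (1%:M - x *m (z *m (y *m P))) *m (Q *m T).
  rewrite mulmxBr mulmx1 mulmxBl -!mulmxA; rewrite -!mulmxA in yMT.
  by rewrite yMT !mulmx0 subr0.
exact: qrankMlr.
Qed.

Lemma mx_factor_ker m p n (M : 'M[H]_(m, n)) (N : 'M[H]_(p, n)) :
  (forall v : 'cV_n, N *m v = 0 -> M *m v = 0) -> exists L, M = L *m N.
Proof.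
move=> kerNM; have [G NGN _] := ginv_exists N.
exists (M *m G); apply/eqP; rewrite -subr_eq0 -mulmxA; apply/eqP/matrixP => i j.
have /matrixP/(_ i 0) : M *m col j (1%:M - G *m N) = 0.
  by apply: kerNM; rewrite colE mulmxA mulmxBr mulmx1 mulmxA NGN subrr mul0mx.
by rewrite colE (mulmxA M (_ - _)) -colE mulmxBr mulmx1 !mxE.
Qed.

Lemma qrank_col_lt m n p (M : 'M[H]_(m, n)) (C : 'M[H]_(p, n)) (w : 'cV[H]_n) :
  M *m w = 0 -> C *m w != 0 -> (qrank M < qrank (col_mx M C))%N.
Proof.
move=> Mw Cw; have ME : M = row_mx I 0 *m col_mx M C.
  by rewrite mul_row_col mul1mx mul0mx addr0.
rewrite {1}ME; apply: (qrankMl_lt (v := w)); first by rewrite -ME.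
by rewrite mul_col_mx Mw; apply: contra Cw => /eqP; rewrite -{1}col_mx0;
  move/eq_col_mx => [_ ->].
Qed.

(** The residue [(1 - M G) B] either vanishes, so that [B = M (G B)], or pairs to 1 with a row and a
    column. *)
Lemma mx_row_dichotomy m n p (M : 'M[H]_(m, n)) (B : 'M[H]_(m, p)) :
  (exists U, B = M *m U) \/
  (exists (y : 'rV_m) (u : 'cV_p), y *m M = 0 /\ y *m (B *m u) = 1%:M).
Proof.
have [G MGM _] := ginv_exists M.
have [/eqP|/mx_pairing[y [u yu]]] := eqVneq ((1%:M - M *m G) *m B) 0.
  by rewrite mulmxBl mul1mx subr_eq0 -mulmxA => /eqP BE; left; exists (G *m B).
right; exists (y *m (1%:M - M *m G)), u; split; last by rewrite !mulmxA in yu *.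
by rewrite -mulmxA mulmxBl mul1mx MGM subrr mulmx0.
Qed.

Lemma mx_col_dichotomy m n p (M : 'M[H]_(m, n)) (C : 'M[H]_(p, n)) :
  (exists L, C = L *m M) \/
  (exists (e : 'rV_p) (w : 'cV_n), M *m w = 0 /\ e *m C *m w = 1%:M).
Proof.
have [G MGM _] := ginv_exists M.
have [/eqP|/mx_pairing[e [w ew]]] := eqVneq (C *m (1%:M - G *m M)) 0.
  by rewrite mulmxBr mulmx1 subr_eq0 mulmxA => /eqP CE; left; exists (C *m G).
right; exists e, ((1%:M - G *m M) *m w); split; last by rewrite !mulmxA in ew *.
by rewrite mulmxA mulmxBr mulmx1 mulmxA MGM subrr mul0mx.
Qed.

(* Exactly the situation in which some update [M - B *m X *m C] has smaller
   rank than [M]. *)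
Definition linked m n p q (B : 'M[H]_(m, p)) (C : 'M[H]_(q, n))
    (M : 'M[H]_(m, n)) :=
  exists (v : 'cV_n) (u : 'cV_p) (z : 'rV_m) (e : 'rV_q),
    [/\ M *m v = B *m u, z *m M = e *m C & z *m M *m v = 1%:M].

(** Clearing [M] from [[M B; C 0]] leaves [C G B] up to sign. A positive gap means that it stays
    nonzero modulo the rows of [E B] and the columns of [C F]; pairing it to 1 gives the
    witnesses. *)
Lemma qrank_gap_linked m n p q (M : 'M[H]_(m, n)) (B : 'M[H]_(m, p))
    (C : 'M[H]_(q, n)) :
  (qrank (row_mx M B) + qrank (col_mx M C)
     < qrank M + qrank (block_mx M B C 0))%N ->
  linked B C M.
Proof.
have [G MGM GMG] := ginv_exists M.
set E := 1%:M - M *m G; set F := 1%:M - G *m M.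
have EM : E *m M = 0 by rewrite mulmxBl mul1mx MGM subrr.
have MF : M *m F = 0 by rewrite mulmxBr mulmx1 mulmxA MGM subrr.
have rowE : (qrank M + qrank (E *m B) <= qrank (row_mx M B))%N.
  apply: leq_trans (qrank_ublock_ge _ (M *m G *m B) _) _.
  have -> : block_mx M (M *m G *m B) 0 (E *m B) =
      col_mx (M *m G) E *m row_mx M B.
    by rewrite mul_col_row MGM EM.
  exact: qrankMl.
have colE : (qrank M + qrank (C *m F) <= qrank (col_mx M C))%N.
  rewrite addnC; apply: leq_trans (qrank_ublock_ge _ (C *m G *m M) _) _.
  have -> : block_mx (C *m F) (C *m G *m M) 0 M =
      col_mx C M *m row_mx F (G *m M).
    by rewrite mul_col_row MF !mulmxA MGM.
  apply: leq_trans (qrankMr _ _) _.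
  have -> : col_mx C M = block_mx 0 1%:M 1%:M 0 *m col_mx M C.
    by rewrite mul_block_col !mul0mx !mul1mx add0r addr0.
  exact: qrankMl.
have [H1 EH _] := ginv_exists (E *m B).
have [K1 CK _] := ginv_exists (C *m F).
set D := C *m G *m B.
move=> gap.
have [e [u eu]] : exists (e : 'rV_q) (u : 'cV_p),
    e *m ((1%:M - C *m F *m K1) *m D *m (1%:M - H1 *m (E *m B))) *m u = 1%:M.
  (* Otherwise [D = X (E B) + (C F) Y], and the block matrix is a sum of three terms of ranks at
     most [r(M)], [r(E B)] and [r(C F)], against the gap. *)
  apply: mx_pairing; apply: contraL gap; rewrite -leqNgt => /eqP D0.
  pose X := (1%:M - C *m F *m K1) *m D *m H1; pose Y := K1 *m D.
  have DE : D = X *m (E *m B) + C *m F *m Y.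
    move/eqP: D0; rewrite mulmxBr mulmx1 subr_eq0 [in X in X == _]mulmxBl.
    rewrite mul1mx.
    by rewrite subr_eq => /eqP ->; rewrite /X /Y !mulmxA.
  have blockE : block_mx M B C 0 = col_mx I (C *m G) *m M *m row_mx I (G *m B)
      + (col_mx I (- X) *m (E *m B) *m row_mx O 1%:M
      + col_mx O 1%:M *m (C *m F) *m row_mx I (- Y)).
    rewrite !mul_col_mx !mul_mx_row !mul1mx !mulmx1 !mulmx0 !mul0mx.
    rewrite !add_col_mx !add_row_mx -block_mxEv add0r !addr0; congr block_mx.
    - by rewrite mulmxBl mul1mx !mulmxA addrC subrK.
    - by rewrite add0r mulmxBr mulmx1 !mulmxA addrC subrK.
    rewrite !mulmxA -(mulmxA C) -(mulmxA C) GMG -/D DE mulmxN mulNmx !mulmxA.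
    by rewrite !mulNmx -opprD subrr.
  have: (qrank (block_mx M B C 0) <=
      qrank M + (qrank (E *m B) + qrank (C *m F)))%N.
    rewrite blockE; apply: leq_trans (qrankD _ _) _.
    rewrite leq_add ?qrankMlr //.
    by apply: leq_trans (qrankD _ _) _; rewrite leq_add ?qrankMlr.
  lia.
(* With the projections absorbed, [e' C] lies in the row space of [M] and [B u'] in its column
   space, so [G] produces [z] and [v]. *)
set e' := e *m (1%:M - C *m F *m K1); set u' := (1%:M - H1 *m (E *m B)) *m u.
have eCF : e' *m C *m F = 0.
  by rewrite -mulmxA /e' -mulmxA mulmxBl mul1mx CK subrr mulmx0.
have EBu : E *m (B *m u') = 0.
  by rewrite mulmxA /u' mulmxA mulmxBr mulmx1 (mulmxA (E *m B)) EH subrr mul0mx.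
have eC : e' *m C *m G *m M = e' *m C.
  apply/esym/eqP; rewrite -subr_eq0 -(mulmxA _ G).
  by rewrite -[X in X - _]mulmx1 -mulmxBr eCF.
have Bu : M *m (G *m (B *m u')) = B *m u'.
  apply/esym/eqP; rewrite -subr_eq0 mulmxA.
  by rewrite -[X in X - _]mul1mx -mulmxBl EBu.
exists (G *m (B *m u')), u', (e' *m C *m G), e'; split => //.
by rewrite eC -eu /e' /u' /D !mulmxA.
Qed.

End RankGap.

(** * Two simultaneous two-sided updates *)

Section TwoSidedUpdates.
Variable R : realType.
Local Notation H := (quaternion R).
Local Notation I := (1%:M : 'M[H]__).
Local Notation O := (0 : 'M[H]_(_, _)).

(** * Updates that raise the rank *)

Lemma mx11_one_neq0 : 1%:M != 0 :> 'M[H]_1.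
Proof. by apply/eqP => /matrixP/(_ 0 0)/eqP; rewrite !mxE oner_eq0. Qed.

(** Multiplying the sum [N] by [y] isolates [e C], and then [M] is recovered. So [[M; e C]] is a
    left multiple of [N], while [w] shows that its rank exceeds that of [M]. *)
Lemma qrank_update_gt m n p q (M : 'M[H]_(m, n)) (B : 'M[H]_(m, p))
    (C : 'M[H]_(q, n)) (y : 'rV_m) (u : 'cV_p) (e : 'rV_q) (w : 'cV_n) :
  y *m M = 0 -> y *m (B *m u) = 1%:M -> M *m w = 0 -> e *m C *m w = 1%:M ->
  (qrank M < qrank (M + B *m (u *m e) *m C))%N.
Proof.
move=> yM yBu Mw eCw; set N := M + _.
have NE : N = M + B *m u *m (e *m C) by rewrite /N !mulmxA.
have yN : e *m C = y *m N.
  by rewrite NE mulmxDr yM add0r mulmxA yBu mul1mx.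
have ME : M = (1%:M - B *m u *m y) *m N.
  by rewrite mulmxBl mul1mx -(mulmxA _ y) -yN NE addrK.
apply: (@leq_trans (qrank (col_mx M (e *m C)))).
  by apply: qrank_col_lt Mw _; rewrite eCw mx11_one_neq0.
by rewrite {1}ME yN -mul_col_mx qrankMl.
Qed.

(* With [p = B *m u] outside the column space of [M] and [q = e *m C] outside
   its row space, a vector killed by [M + M v q + p z M] is killed by [z M], then
   by [q], hence by [M]. *)
Lemma qrank_cross_update_gt m n p q p' q' (M : 'M[H]_(m, n))
    (B : 'M[H]_(m, p)) (C : 'M[H]_(q, n)) (B' : 'M[H]_(m, p'))
    (C' : 'M[H]_(q', n)) (y : 'rV_m) (u : 'cV_p) (e : 'rV_q) (w : 'cV_n) :
  y *m M = 0 -> y *m (B *m u) = 1%:M -> M *m w = 0 -> e *m C *m w = 1%:M ->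
  linked B' C' M ->
  exists Y Y', (qrank M < qrank (M + B *m Y *m C' + B' *m Y' *m C))%N.
Proof.
move=> yM yBu Mw eCw [v [u' [z [e' [Mv zM zMv]]]]].
exists (u *m e'), (u' *m e); set N := M + _ + _.
have NE : N = M + B *m u *m (z *m M) + M *m v *m (e *m C).
  by rewrite zM Mv /N !mulmxA.
have yN : y *m N = z *m M.
  rewrite NE !mulmxDr yM add0r (mulmxA y (B *m u)) yBu mul1mx.
  by rewrite (mulmxA y (M *m v)) (mulmxA y M) yM !mul0mx addr0.
set T := 1%:M - B *m u *m y.
have TN : T *m N = M + M *m v *m (e *m C).
  by rewrite mulmxBl mul1mx -(mulmxA _ y) yN NE addrAC addrK.
have eC : e *m C = (z *m T - y) *m N.
  rewrite mulmxBl yN -mulmxA TN mulmxDr (mulmxA z (M *m v)) (mulmxA z M v) zMv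
      mul1mx.
  by rewrite addrC addKr.
have ME : M = (T - M *m v *m (z *m T - y)) *m N.
  by rewrite mulmxBl TN -(mulmxA _ _ N) -eC addrK.
apply: (@leq_trans (qrank (col_mx M (e *m C)))).
  by apply: qrank_col_lt Mw _; rewrite eCw mx11_one_neq0.
by rewrite {1}ME eC -mul_col_mx qrankMl.
Qed.

Lemma qrank_two_update_gt m n p3 q3 p4 q4 (M : 'M[H]_(m, n))
    (B3 : 'M[H]_(m, p3)) (C3 : 'M[H]_(q3, n))
    (B4 : 'M[H]_(m, p4)) (C4 : 'M[H]_(q4, n)) :
  (qrank M < qrank (row_mx M (row_mx B3 B4)))%N ->
  (qrank M < qrank (col_mx M (col_mx C3 C4)))%N ->
  (qrank M < qrank (block_mx M B3 C4 0))%N ->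
  (qrank M < qrank (block_mx M B4 C3 0))%N ->
  exists Y3 Y4, (qrank M < qrank (M + B3 *m Y3 *m C3 + B4 *m Y4 *m C4))%N.
Proof.
move=> gtB gtC gt34 gt43.
have single3 : (exists Y3, (qrank M < qrank (M + B3 *m Y3 *m C3))%N) ->
    exists Y3 Y4, (qrank M < qrank (M + B3 *m Y3 *m C3 + B4 *m Y4 *m C4))%N.
  by case=> Y3 gtY; exists Y3, 0; rewrite mulmx0 mul0mx addr0.
have single4 : (exists Y4, (qrank M < qrank (M + B4 *m Y4 *m C4))%N) ->
    exists Y3 Y4, (qrank M < qrank (M + B3 *m Y3 *m C3 + B4 *m Y4 *m C4))%N.
  by case=> Y4 gtY; exists 0, Y4; rewrite mulmx0 mul0mx addr0.
(* When [B] and [C] factor through [M], both one-sided borders preserve its rank, so the hypothesis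
   on the block rank is a positive gap. *)
have gap p q (B : 'M[H]_(m, p)) (C : 'M[H]_(q, n)) U L : B = M *m U ->
    C = L *m M -> (qrank M < qrank (block_mx M B C 0))%N -> linked B C M.
  move=> -> -> gtM; apply: qrank_gap_linked.
  have -> : row_mx M (M *m U) = M *m row_mx 1%:M U by rewrite mul_mx_row mulmx1.
  have -> : col_mx M (L *m M) = col_mx 1%:M L *m M by rewrite mul_col_mx mul1mx.
  have := qrankMr M (row_mx 1%:M U); have := qrankMl (col_mx 1%:M L) M; lia.
(* Each of [B3], [B4], [C3], [C4] factors through [M] or has a witness outside it. If [B3], [C3] or
   [B4], [C4] are both outside, one update suffices; [gtB] and [gtC] exclude that [B3], [B4] or
   [C3], [C4] are both inside. *)
have [[U3 B3E]|[y3 [u3 [yM3 yBu3]]]] := mx_row_dichotomy M B3;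
have [[U4 B4E]|[y4 [u4 [yM4 yBu4]]]] := mx_row_dichotomy M B4;
have [[L3 C3E]|[e3 [w3 [Mw3 eCw3]]]] := mx_col_dichotomy M C3;
have [[L4 C4E]|[e4 [w4 [Mw4 eCw4]]]] := mx_col_dichotomy M C4;
try by [apply: single3; exists (u3 *m e3);
          apply: qrank_update_gt yM3 yBu3 Mw3 eCw3
       | apply: single4; exists (u4 *m e4);
          apply: qrank_update_gt yM4 yBu4 Mw4 eCw4].
all: try (exfalso; move: gtB; rewrite B3E B4E -mul_mx_row;
  by rewrite -[X in row_mx X _]mulmx1 -mul_mx_row ltnNge qrankMr).
all: try (exfalso; move: gtC; rewrite C3E C4E -mul_col_mx;
  by rewrite -[X in col_mx X _]mul1mx -mul_col_mx ltnNge qrankMl).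
(* In the two remaining cases one [B] and the opposite [C] are inside, hence linked, and the other
   two are outside. *)
- have l34 := gap _ _ _ _ _ _ B3E C4E gt34.
  have [Y4 [Y3 gtY]] := qrank_cross_update_gt yM4 yBu4 Mw3 eCw3 l34.
  by exists Y3, Y4; rewrite addrAC.
- exact: qrank_cross_update_gt yM3 yBu3 Mw4 eCw4 (gap _ _ _ _ _ _ B4E C3E gt43).
Qed.

(** * Updates that lower the rank *)

Lemma linked_common_col m n p q3 q4 (M : 'M[H]_(m, n)) (B : 'M[H]_(m, p))
    (C3 : 'M[H]_(q3, n)) (C4 : 'M[H]_(q4, n)) :
  linked B C3 M -> linked B C4 M ->
  exists (v : 'cV_n) (u : 'cV_p) (z3 z4 : 'rV_m) (e3 : 'rV_q3) (e4 : 'rV_q4),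
    [/\ M *m v = B *m u, z3 *m M = e3 *m C3, z4 *m M = e4 *m C4,
        z3 *m M *m v = 1%:M & z4 *m M *m v = 1%:M].
Proof.
move=> [v3 [u3 [z3 [e3 [Mv3 zM3 zMv3]]]]] [v4 [u4 [z4 [e4 [Mv4 zM4 zMv4]]]]].
(* One [v] on which [z3 M] and [z4 M] are both nonzero suffices, since rows may be rescaled on the
   left. If neither [v3] nor [v4] works, [v3 + v4] does. *)
suff [v [u [Mv nz3 nz4]]] : exists (v : 'cV_n) (u : 'cV_p),
    [/\ M *m v = B *m u, z3 *m M *m v != 0 & z4 *m M *m v != 0].
  have [b3 b3K _] := mx11_inv nz3; have [b4 b4K _] := mx11_inv nz4.
  exists v, u, (b3 *m z3), (b4 *m z4), (b3 *m e3), (b4 *m e4).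
  split=> //; first by rewrite -!mulmxA zM3.
  - by rewrite -!mulmxA zM4.
  - by rewrite -b3K !mulmxA.
  by rewrite -b4K !mulmxA.
have nz := mx11_one_neq0.
have [z43|z43] := eqVneq (z4 *m M *m v3) 0; last first.
  by exists v3, u3; rewrite zMv3.
have [z34|z34] := eqVneq (z3 *m M *m v4) 0; last first.
  by exists v4, u4; rewrite zMv4.
by exists (v3 + v4), (u3 + u4); rewrite !mulmxDr Mv3 Mv4 z34 z43 zMv3 zMv4
  addr0 add0r.
Qed.

Lemma linked_common_row m n p3 p4 q (M : 'M[H]_(m, n)) (B3 : 'M[H]_(m, p3))
    (B4 : 'M[H]_(m, p4)) (C : 'M[H]_(q, n)) :
  linked B3 C M -> linked B4 C M ->
  exists (z : 'rV_m) (e : 'rV_q) (v3 v4 : 'cV_n) (u3 : 'cV_p3) (u4 : 'cV_p4),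
    [/\ z *m M = e *m C, M *m v3 = B3 *m u3, M *m v4 = B4 *m u4,
        z *m M *m v3 = 1%:M & z *m M *m v4 = 1%:M].
Proof.
move=> [v3 [u3 [z3 [e3 [Mv3 zM3 zMv3]]]]] [v4 [u4 [z4 [e4 [Mv4 zM4 zMv4]]]]].
suff [z [e [zM nz3 nz4]]] : exists (z : 'rV_m) (e : 'rV_q),
    [/\ z *m M = e *m C, z *m M *m v3 != 0 & z *m M *m v4 != 0].
  have [b3 _ b3K] := mx11_inv nz3; have [b4 _ b4K] := mx11_inv nz4.
  exists z, e, (v3 *m b3), (v4 *m b4), (u3 *m b3), (u4 *m b4).
  by rewrite !mulmxA b3K b4K Mv3 Mv4.
have nz := mx11_one_neq0.
have [z43|z43] := eqVneq (z4 *m M *m v3) 0; last first.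
  by exists z4, e4; rewrite zMv4.
have [z34|z34] := eqVneq (z3 *m M *m v4) 0; last first.
  by exists z3, e3; rewrite zMv3.
by exists (z3 + z4), (e3 + e4); rewrite !mulmxDl zM3 zM4 -zM3 -zM4 z34 z43
  zMv3 zMv4 addr0 add0r.
Qed.

(** With a common [v], the joint update is a left multiple [T M]. The two parts of [u] together
    subtract exactly [M v], so [T M v = 0] although [M v] is nonzero. *)
Lemma qrank_joint_update_lt_col m n p3 q3 p4 q4 (M : 'M[H]_(m, n))
    (B3 : 'M[H]_(m, p3)) (C3 : 'M[H]_(q3, n))
    (B4 : 'M[H]_(m, p4)) (C4 : 'M[H]_(q4, n)) :
  linked (row_mx B3 B4) C3 M -> linked (row_mx B3 B4) C4 M ->
  exists Y3 Y4, (qrank (M - B3 *m Y3 *m C3 - B4 *m Y4 *m C4) < qrank M)%N.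
Proof.
move=> l3 l4.
have [v [u [z3 [z4 [e3 [e4 [Mv zM3 zM4 zMv3 zMv4]]]]]]] :=
  linked_common_col l3 l4.
rewrite -[u]vsubmxK mul_row_col in Mv.
exists (usubmx u *m e3), (dsubmx u *m e4).
set T := 1%:M - B3 *m usubmx u *m z3 - B4 *m dsubmx u *m z4.
have -> : M - B3 *m (usubmx u *m e3) *m C3 - B4 *m (dsubmx u *m e4) *m C4
    = T *m M.
  by rewrite !mulmxBl mul1mx -!mulmxA zM3 zM4 !mulmxA.
apply: (qrankMl_lt (v := v)).
  rewrite -mulmxA !mulmxBl mul1mx -!(mulmxA _ _ (M *m v)).
  by rewrite !(mulmxA _ M) zMv3 zMv4 !mulmx1 Mv addrAC addrK subrr.
by apply/eqP => Mv0; move: mx11_one_neq0; rewrite -zMv3 -mulmxA Mv0 mulmx0 eqxx.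
Qed.

Lemma qrank_joint_update_lt_row m n p3 q3 p4 q4 (M : 'M[H]_(m, n))
    (B3 : 'M[H]_(m, p3)) (C3 : 'M[H]_(q3, n))
    (B4 : 'M[H]_(m, p4)) (C4 : 'M[H]_(q4, n)) :
  linked B3 (col_mx C3 C4) M -> linked B4 (col_mx C3 C4) M ->
  exists Y3 Y4, (qrank (M - B3 *m Y3 *m C3 - B4 *m Y4 *m C4) < qrank M)%N.
Proof.
move=> l3 l4.
have [z [e [v3 [v4 [u3 [u4 [zM Mv3 Mv4 zMv3 zMv4]]]]]]] :=
  linked_common_row l3 l4.
rewrite -[e]hsubmxK mul_row_col in zM.
exists (u3 *m lsubmx e), (u4 *m rsubmx e).
set T := 1%:M - v3 *m lsubmx e *m C3 - v4 *m rsubmx e *m C4.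
have -> : M - B3 *m (u3 *m lsubmx e) *m C3 - B4 *m (u4 *m rsubmx e) *m C4
    = M *m T.
  by rewrite !mulmxBr mulmx1 !mulmxA Mv3 Mv4.
apply: (qrankMr_lt (y := z)).
  rewrite mulmxA !mulmxBr mulmx1 !mulmxA zMv3 zMv4 !mul1mx zM.
  by rewrite addrAC addrK subrr.
by apply/eqP => zM0; move: mx11_one_neq0; rewrite -zMv3 zM0 mul0mx eqxx.
Qed.

(** A left multiple of [M] of no smaller rank has no larger kernel, so [M] factors back through it;
    this carries the row [z M] over to the updated matrix. *)
Lemma linked_neutral_update m n (M : 'M[H]_(m, n)) (v : 'cV[H]_n)
    (z : 'rV[H]_m) (b c : 'cV_m) :
  M *m v = b + c -> z *m M *m v = 1%:M ->
  (qrank M <= qrank (M - b *m (z *m M)))%N ->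
  (M - b *m (z *m M)) *m v = c /\
  exists z', z' *m (M - b *m (z *m M)) = z *m M.
Proof.
move=> Mv zMv leM; split.
  by rewrite mulmxBl -mulmxA zMv mulmx1 Mv addrC addKr.
have NE : M - b *m (z *m M) = (1%:M - b *m z) *m M.
  by rewrite mulmxBl mul1mx mulmxA.
have [|L ME] := @mx_factor_ker R _ _ _ M (M - b *m (z *m M)).
  move=> x; rewrite NE => Nx; apply/eqP; apply: contraTT leM => Mx.
  by rewrite -ltnNge NE (qrankMl_lt Nx).
by exists (z *m L); rewrite -mulmxA -ME.
Qed.

(** Let [g(B, C)] be the gap [r(M) + r[M B; C 0] - r[M B] - r[M; C]]. The hypothesis reads
    [g(B', C) + g(B, C') > g(B, C) >= 0]. Without a link between [B'] and [C] the first term is 0,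
    so [g(B, C')] is positive. *)
Lemma linked_of_gap_sub m n p p' q q' (M : 'M[H]_(m, n)) (B : 'M[H]_(m, p))
    (B' : 'M[H]_(m, p')) (C : 'M[H]_(q, n)) (C' : 'M[H]_(q', n)) :
  (qrank (col_mx M C') + qrank (row_mx M B') + qrank (block_mx M B C 0%R)
     < qrank M + qrank (block_mx M B' C 0%R) + qrank (block_mx M B C' 0%R))%N ->
  ~ linked B' C M -> linked B C' M.
Proof.
move=> gap nl; apply: qrank_gap_linked.
have := qrank_block_submod M B C 0.
have : (qrank M + qrank (block_mx M B' C 0%R)
    <= qrank (row_mx M B') + qrank (col_mx M C))%N.
  by rewrite leqNgt; apply/negP => /qrank_gap_linked.
lia.
Qed.

(** * Shift invariance and bounds of block ranks *)

Lemma qrank_shift_row m n p (A : 'M[H]_(m, n)) (B : 'M[H]_(m, p)) U :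
  qrank (row_mx (A - B *m U) B) = qrank (row_mx A B).
Proof.
have le (M : 'M[H]_(m, n)) V :
    (qrank (row_mx (M - B *m V) B) <= qrank (row_mx M B))%N.
  have -> : row_mx (M - B *m V) B = row_mx M B *m block_mx 1%:M 0 (- V) 1%:M.
    by rewrite mul_row_block !mulmx1 mulmx0 add0r mulmxN.
  exact: qrankMr.
(* The reverse inequality is the same bound for the opposite shift. *)
apply/eqP; rewrite eqn_leq le /= -{1}[A](subrK (B *m U)).
rewrite -[X in _ + X]opprK -mulmxN.
exact: le.
Qed.

Lemma qrank_shift_col m n q (A : 'M[H]_(m, n)) (C : 'M[H]_(q, n)) L :
  qrank (col_mx (A - L *m C) C) = qrank (col_mx A C).
Proof.
have le (M : 'M[H]_(m, n)) V :
    (qrank (col_mx (M - V *m C) C) <= qrank (col_mx M C))%N.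
  have -> : col_mx (M - V *m C) C = block_mx 1%:M (- V) 0 1%:M *m col_mx M C.
    by rewrite mul_block_col !mul1mx mul0mx add0r mulNmx.
  exact: qrankMl.
apply/eqP; rewrite eqn_leq le /= -{1}[A](subrK (L *m C)).
rewrite -[X in _ + X]opprK -mulNmx.
exact: le.
Qed.

Lemma qrank_shift_block m n p q (A : 'M[H]_(m, n)) (B : 'M[H]_(m, p))
    (C : 'M[H]_(q, n)) U L :
  qrank (block_mx (A - B *m U - L *m C) B C 0) = qrank (block_mx A B C 0).
Proof.
have le (M : 'M[H]_(m, n)) V K :
    (qrank (block_mx (M - B *m V - K *m C) B C 0)
       <= qrank (block_mx M B C 0))%N.
  have -> : block_mx (M - B *m V - K *m C) B C 0 =
      block_mx 1%:M (- K) 0 1%:M *m block_mx M B C 0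
        *m block_mx 1%:M 0 (- V) 1%:M.
    rewrite !mulmx_block !(mul1mx, mulmx1, mul0mx, mulmx0, addr0, add0r).
    by rewrite mulmxN mulNmx addrAC.
  exact: qrankMlr.
apply/eqP; rewrite eqn_leq le /=.
have := le (A - B *m U - L *m C) (- U) (- L).
by rewrite mulmxN mulNmx !opprK addrAC !subrK.
Qed.

(** A witness with [M v] split between [B3] and [B4] is pushed into [B4] alone, unless the update
    along [B3] already lowers the rank. *)
Lemma qrank_neutral_update m n p3 q3 p4 (M : 'M[H]_(m, n))
    (B3 : 'M[H]_(m, p3)) (C3 : 'M[H]_(q3, n)) (B4 : 'M[H]_(m, p4))
    (v : 'cV_n) (u3 : 'cV_p3) (u4 : 'cV_p4) (z : 'rV_m) (e : 'rV_q3) :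
  M *m v = B3 *m u3 + B4 *m u4 -> z *m M = e *m C3 -> z *m M *m v = 1%:M ->
  let N := M - B3 *m (u3 *m e) *m C3 in
  (qrank N < qrank M)%N \/
  qrank N = qrank M /\
    exists z', [/\ N *m v = B4 *m u4, z' *m N = e *m C3 & z' *m N *m v = 1%:M].
Proof.
move=> Mv zM zMv N; have NE : N = M - B3 *m u3 *m (z *m M).
  by rewrite /N zM !mulmxA.
have [ltN|leN] := ltnP (qrank N) (qrank M); [by left | right].
move: leN; rewrite NE => leN.
have [Nv [z' z'N]] := linked_neutral_update Mv zMv leN.
split; last by exists z'; rewrite Nv z'N zMv zM.
apply/eqP; rewrite eqn_leq leN andbT.
rewrite (_ : M - _ = (1%:M - B3 *m u3 *m z) *m M) ?qrankMl //.
by rewrite mulmxBl mul1mx mulmxA.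
Qed.

Lemma qrank_row_ge m n p (M : 'M[H]_(m, n)) (B : 'M[H]_(m, p)) :
  (qrank M <= qrank (row_mx M B))%N.
Proof.
have {1}-> : M = row_mx M B *m col_mx I 0.
  by rewrite mul_row_col mulmx1 mulmx0 addr0.
exact: qrankMr.
Qed.

Lemma qrank_col_ge m n p (M : 'M[H]_(m, n)) (C : 'M[H]_(p, n)) :
  (qrank M <= qrank (col_mx M C))%N.
Proof.
have {1}-> : M = row_mx I 0 *m col_mx M C.
  by rewrite mul_row_col mul1mx mul0mx addr0.
exact: qrankMl.
Qed.

Lemma qrank_block_ge m n p q (M : 'M[H]_(m, n)) (B : 'M[H]_(m, p))
    (C : 'M[H]_(q, n)) D : (qrank M <= qrank (block_mx M B C D))%N.
Proof.
by rewrite block_mxEv; apply: leq_trans (qrank_row_ge _ B) (qrank_col_ge _ _).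
Qed.

(** Submodularity is used at [M] with [B], [C'] and at [[M B]] with [B'], [C]; the terms [r[M B]]
    cancel. As [B] is a right multiple of [B'], its columns add nothing beside [B']. *)
Lemma qrank_gap_ge m n p p' q q' (M : 'M[H]_(m, n)) (B : 'M[H]_(m, p))
    (B' : 'M[H]_(m, p')) S (C : 'M[H]_(q, n)) (C' : 'M[H]_(q', n)) :
  B = B' *m S ->
  (qrank (col_mx M C') + qrank (row_mx M B') + qrank (block_mx M B C 0%R)
     <= qrank M + qrank (block_mx M B' C 0%R) + qrank (block_mx M B C' 0%R))%N.
Proof.
move=> BE; have sub1 := qrank_block_submod M B C' 0.
have := qrank_block_submod (row_mx M B) B' (row_mx C 0) 0.
rewrite -block_mxEv.
have : (qrank (block_mx (row_mx M B) B' (row_mx C 0) 0%R)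
    <= qrank (block_mx M B' C 0%R))%N.
  have -> : block_mx (row_mx M B) B' (row_mx C 0) 0 =
      block_mx M B' C 0 *m block_mx (row_mx I 0) 0 (row_mx 0 S) 1%:M.
    rewrite mulmx_block !mul_mx_row !(mulmx0, mulmx1, mul0mx, addr0, add0r).
    by rewrite !add_row_mx !addr0 add0r BE.
  exact: qrankMr.
have : (qrank (row_mx M B') <= qrank (row_mx (row_mx M B) B'))%N.
  have -> : row_mx M B' =
      row_mx (row_mx M B) B' *m block_mx (col_mx I 0) 0 0 1%:M.
    rewrite mul_row_block mul_row_col.
    by rewrite !(mulmx0, mulmx1, addr0, add0r).
  exact: qrankMr.
lia.
Qed.

(** * Extremal ranks under two two-sided updates *)

Section TwoUpdates.
Context {m n p3 q3 p4 q4 : nat}.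
Variables (B3 : 'M[H]_(m, p3)) (C3 : 'M[H]_(q3, n)).
Variables (B4 : 'M[H]_(m, p4)) (C4 : 'M[H]_(q4, n)).
Implicit Types (A M : 'M[H]_(m, n)) (X : 'M[H]_(p3, q3)) (Y : 'M[H]_(p4, q4)).

Local Notation B34 := (row_mx B3 B4).
Local Notation C34 := (col_mx C3 C4).

Definition two_update A X Y := A - B3 *m X *m C3 - B4 *m Y *m C4.

Lemma two_update0 A : two_update A 0 0 = A.
Proof. by rewrite /two_update !mulmx0 !mul0mx !subr0. Qed.

Lemma two_updateD A X Y X' Y' :
  two_update (two_update A X Y) X' Y' = two_update A (X + X') (Y + Y').
Proof.
rewrite /two_update !mulmxDr !mulmxDl !opprD !addrA.
by congr (_ + _); rewrite addrAC.
Qed.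

Lemma qrank_two_update_row A X Y :
  qrank (row_mx (two_update A X Y) B34) = qrank (row_mx A B34).
Proof.
rewrite -(qrank_shift_row A B34 (col_mx (X *m C3) (Y *m C4))) mul_row_col.
by rewrite opprD addrA !mulmxA.
Qed.

Lemma qrank_two_update_col A X Y :
  qrank (col_mx (two_update A X Y) C34) = qrank (col_mx A C34).
Proof.
rewrite -(qrank_shift_col A C34 (row_mx (B3 *m X) (B4 *m Y))) mul_row_col.
by rewrite opprD addrA.
Qed.

Lemma qrank_two_update34 A X Y :
  qrank (block_mx (two_update A X Y) B3 C4 0) = qrank (block_mx A B3 C4 0).
Proof. by rewrite -(qrank_shift_block A B3 C4 (X *m C3) (B4 *m Y)) !mulmxA. Qed.

Lemma qrank_two_update43 A X Y :
  qrank (block_mx (two_update A X Y) B4 C3 0) = qrank (block_mx A B4 C3 0).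
Proof.
by rewrite -(qrank_shift_block A B4 C3 (Y *m C4) (B3 *m X)) !mulmxA addrAC.
Qed.

Lemma qrank_two_update_rows q (C : 'M[H]_(q, n)) A X Y :
  qrank (block_mx (two_update A X Y) B34 C 0) = qrank (block_mx A B34 C 0).
Proof.
rewrite -(qrank_shift_block A B34 C (col_mx (X *m C3) (Y *m C4)) 0).
by rewrite mul_row_col mul0mx subr0 opprD addrA !mulmxA.
Qed.

Lemma qrank_two_update_cols p (B : 'M[H]_(m, p)) A X Y :
  qrank (block_mx (two_update A X Y) B C34 0) = qrank (block_mx A B C34 0).
Proof.
rewrite -(qrank_shift_block A B C34 0 (row_mx (B3 *m X) (B4 *m Y))).
by rewrite mul_row_col mulmx0 subr0 opprD addrA.
Qed.

(** Strict excess of [r(M)] over the bound behind [s1], written additively because natural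
    subtraction truncates. The block ranks are taken at [A], since updates preserve them. *)
Definition gap34 A M : Prop :=
  (qrank (col_mx A C34) + qrank (row_mx A B34) + qrank (block_mx A B3 C4 0%R)
   < qrank M + qrank (block_mx A B34 C4 0%R) + qrank (block_mx A B3 C34 0%R))%N.

Definition gap43 A M : Prop :=
  (qrank (col_mx A C34) + qrank (row_mx A B34) + qrank (block_mx A B4 C3 0%R)
   < qrank M + qrank (block_mx A B34 C3 0%R) + qrank (block_mx A B4 C34 0%R))%N.

Definition improvable M := exists X Y, (qrank (two_update M X Y) < qrank M)%N.

(** Updates compose, so a rank-preserving one may precede one that lowers the rank. *)
Lemma improvable_two_update M X Y :
  (qrank (two_update M X Y) < qrank M)%N \/
  qrank (two_update M X Y) = qrank M /\ improvable (two_update M X Y) ->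
  improvable M.
Proof.
case=> [lt|[rM [X' [Y' lt]]]]; first by exists X, Y.
by exists (X + X'), (Y + Y'); rewrite -two_updateD -rM.
Qed.

(* When only one of [linked B34 C3 M] and [linked B34 C4 M] holds, say the first,
   a rank-preserving update along [B3] and [C3] moves its witness [M *m v] into
   the column space of [B4]; the new matrix admits a joint update. *)
Lemma gap_improvable M : gap34 M M -> gap43 M M -> improvable M.
Proof.
move=> g34 g43.
have [l3|nl3] := pselect (linked B34 C3 M);
have [l4|nl4] := pselect (linked B34 C4 M).
- exact: qrank_joint_update_lt_col.
- have [v [u [z [e [Mv zM zMv]]]]] := l3.
  rewrite -[u]vsubmxK mul_row_col in Mv.
  apply: (@improvable_two_update M (usubmx u *m e) 0).
  set N := two_update _ _ _.
  have NE : N = M - B3 *m (usubmx u *m e) *m C3.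
    by rewrite /N /two_update mulmx0 mul0mx subr0.
  have [|[rN [z' [Nv z'N z'Nv]]]] := qrank_neutral_update Mv zM zMv.
    by rewrite -NE; left.
  rewrite -NE in rN Nv z'N z'Nv; right; split => //.
  have lN4 : linked B4 C34 N.
    exists v, (dsubmx u), z', (row_mx e 0); split => //.
    by rewrite mul_row_col mul0mx addr0.
  have lN3 : linked B34 C3 N.
    exists v, (col_mx 0 (dsubmx u)), z', e; split => //.
    by rewrite mul_row_col mulmx0 add0r.
  (* If [B34] and [C4] are linked at [N], the column version applies. Otherwise the gap, whose ranks
     are the same at [N] and [M], links [B3] with [C34], and with [lN4] the row version applies. *)
  have [l4|nl4'] := pselect (linked B34 C4 N).
    exact: qrank_joint_update_lt_col.
  apply: qrank_joint_update_lt_row lN4.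
  apply: linked_of_gap_sub nl4'.
  by rewrite qrank_two_update_col qrank_two_update_row qrank_two_update34
    qrank_two_update_rows qrank_two_update_cols rN.
- have [v [u [z [e [Mv zM zMv]]]]] := l4.
  rewrite -[u]vsubmxK mul_row_col addrC in Mv.
  apply: (@improvable_two_update M 0 (dsubmx u *m e)).
  set N := two_update _ _ _.
  have NE : N = M - B4 *m (dsubmx u *m e) *m C4.
    by rewrite /N /two_update mulmx0 mul0mx subr0.
  have [|[rN [z' [Nv z'N z'Nv]]]] := qrank_neutral_update Mv zM zMv.
    by rewrite -NE; left.
  rewrite -NE in rN Nv z'N z'Nv; right; split => //.
  have lN3 : linked B3 C34 N.
    exists v, (usubmx u), z', (row_mx 0 e); split => //.
    by rewrite mul_row_col mul0mx add0r.
  have lN4 : linked B34 C4 N.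
    exists v, (col_mx (usubmx u) 0), z', e; split => //.
    by rewrite mul_row_col mulmx0 addr0.
  have [l3|nl3'] := pselect (linked B34 C3 N).
    exact: qrank_joint_update_lt_col.
  apply: qrank_joint_update_lt_row lN3 _.
  apply: linked_of_gap_sub nl3'.
  by rewrite qrank_two_update_col qrank_two_update_row qrank_two_update43
    qrank_two_update_rows qrank_two_update_cols rN.
(* With neither link, the two gaps link both [B3] and [B4] with [C34]. *)
apply: qrank_joint_update_lt_row.
  exact: linked_of_gap_sub nl4.
exact: linked_of_gap_sub nl3.
Qed.

Lemma qrank_two_update_attains_min A :
  exists X Y, ~ gap34 A (two_update A X Y) \/ ~ gap43 A (two_update A X Y).
Proof.
(* Descent: [k] improvements lower the rank by at least [k], which is impossible for
   [k = r(A) + 1]. *)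
suff H k : exists X Y,
    (~ gap34 A (two_update A X Y) \/ ~ gap43 A (two_update A X Y)) \/
    (qrank (two_update A X Y) + k <= qrank A)%N.
  have [X [Y [//|]]] := H (qrank A).+1; first by exists X, Y.
  by rewrite addnS ltnNge leq_addl.
elim: k => [|k [X [Y [gapXY|leXY]]]].
- by exists 0, 0; right; rewrite two_update0 addn0.
- by exists X, Y; left.
set M := two_update A X Y.
have [g34|n34] := pselect (gap34 A M); last by exists X, Y; left; left.
have [g43|n43] := pselect (gap43 A M); last by exists X, Y; left; right.
have [||X' [Y' lt]] := @gap_improvable M.
- by rewrite /gap34 qrank_two_update_col qrank_two_update_row qrank_two_update34
    qrank_two_update_rows qrank_two_update_cols.
- by rewrite /gap43 qrank_two_update_col qrank_two_update_row qrank_two_update43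
    qrank_two_update_rows qrank_two_update_cols.
exists (X + X'), (Y + Y'); right; rewrite -two_updateD -/M addnS.
by apply: leq_trans leXY; rewrite ltn_add2r.
Qed.

Lemma qrank_two_update_ge34 A X Y :
  (qrank (col_mx A C34) + qrank (row_mx A B34) + qrank (block_mx A B3 C4 0%R)
   <= qrank (two_update A X Y) + qrank (block_mx A B34 C4 0%R)
      + qrank (block_mx A B3 C34 0%R))%N.
Proof.
rewrite -(qrank_two_update_col A X Y) -(qrank_two_update_row A X Y).
rewrite -(qrank_two_update34 A X Y) -(qrank_two_update_rows _ A X Y).
rewrite -(qrank_two_update_cols _ A X Y).
apply: (@qrank_gap_ge _ _ _ _ _ _ _ _ _ (col_mx 1%:M 0)).
by rewrite mul_row_col mulmx1 mulmx0 addr0.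
Qed.

Lemma qrank_two_update_ge43 A X Y :
  (qrank (col_mx A C34) + qrank (row_mx A B34) + qrank (block_mx A B4 C3 0%R)
   <= qrank (two_update A X Y) + qrank (block_mx A B34 C3 0%R)
      + qrank (block_mx A B4 C34 0%R))%N.
Proof.
rewrite -(qrank_two_update_col A X Y) -(qrank_two_update_row A X Y).
rewrite -(qrank_two_update43 A X Y) -(qrank_two_update_rows _ A X Y).
rewrite -(qrank_two_update_cols _ A X Y).
apply: (@qrank_gap_ge _ _ _ _ _ _ _ _ _ (col_mx 0 1%:M)).
by rewrite mul_row_col mulmx1 mulmx0 add0r.
Qed.

Definition two_update_bound A :=
  minn (minn (qrank (col_mx A C34)) (qrank (row_mx A B34)))
    (minn (qrank (block_mx A B3 C4 0)) (qrank (block_mx A B4 C3 0))).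

Lemma qrank_two_update_attains_max A :
  exists X Y, (two_update_bound A <= qrank (two_update A X Y))%N.
Proof.
suff H k : exists X Y, (two_update_bound A <= qrank (two_update A X Y))%N
    \/ (k <= qrank (two_update A X Y))%N.
  have [X [Y [leXY|lt]]] := H (two_update_bound A); by exists X, Y.
elim: k => [|k [X [Y [leXY|leXY]]]]; first by exists 0, 0; right.
  by exists X, Y; left.
have [leA|] := orP (leqVgt (two_update_bound A) (qrank (two_update A X Y))).
  by exists X, Y; left.
rewrite /two_update_bound !leq_min -(qrank_two_update_col A X Y).
rewrite -(qrank_two_update_row A X Y) -(qrank_two_update34 A X Y).
rewrite -(qrank_two_update43 A X Y).
case/andP => /andP[gtC gtB] /andP[gt34 gt43].
have [X' [Y' lt]] := qrank_two_update_gt gtB gtC gt34 gt43.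
(* The updates [X'] and [Y'] were found for addition, while [two_update] subtracts. *)
exists (X - X'), (Y - Y'); right; rewrite -two_updateD /two_update.
rewrite !(mulmxN, mulNmx) !opprK; exact: leq_ltn_trans leXY lt.
Qed.

Lemma qrank_two_update_le A X Y :
  (qrank (two_update A X Y) <= two_update_bound A)%N.
Proof.
rewrite /two_update_bound !leq_min -(qrank_two_update_col A X Y).
rewrite -(qrank_two_update_row A X Y) -(qrank_two_update34 A X Y).
rewrite -(qrank_two_update43 A X Y).
move: (two_update A X Y) => M.
by rewrite qrank_col_ge qrank_row_ge !qrank_block_ge.
Qed.
End TwoUpdates.
End TwoSidedUpdates.

(** * One-sided terms and bordered matrices *)

Section BorderedMatrices.
Variable R : realType.
Local Notation H := (quaternion R).
Local Notation I := (1%:M : 'M[H]__).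
Local Notation O := (0 : 'M[H]_(_, _)).

Section OneSided.
Context {m n k l : nat}.
Variables (B : 'M[H]_(m, k)) (C : 'M[H]_(l, n)).
Implicit Types (M : 'M[H]_(m, n)) (X : 'M[H]_(k, n)) (Y : 'M[H]_(m, l)).

Lemma qrank_one_sided_ge M X Y :
  (qrank (block_mx M B C 0%R)
     <= qrank (M - B *m X - Y *m C) + qrank B + qrank C)%N.
Proof.
rewrite -(qrank_shift_block M B C X Y); move: (_ - _ - _) => N.
have -> : block_mx N B C 0 = col_mx I 0 *m N *m row_mx I 0
    + col_mx I 0 *m B *m row_mx O I
    + col_mx O I *m C *m row_mx I 0.
  rewrite !mul_col_mx !mul_mx_row !(mul1mx, mulmx1, mul0mx, mulmx0).
  by rewrite !add_col_mx !add_row_mx !(addr0, add0r) -block_mxEv.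
do 2!apply: leq_trans (qrankD _ _) (leq_add _ (qrankMlr _ _ _)).
exact: qrankMlr.
Qed.

Lemma qrank_one_sided_attains_min M : exists X Y,
  (qrank (M - B *m X - Y *m C)%R + qrank B + qrank C
     <= qrank (block_mx M B C 0%R))%N.
Proof.
have [Bg BgK _] := ginv_exists B; have [Cg CgK _] := ginv_exists C.
set E := 1%:M - B *m Bg; set F := 1%:M - Cg *m C.
have EB : E *m B = 0 by rewrite mulmxBl mul1mx BgK subrr.
have CF : C *m F = 0 by rewrite mulmxBr mulmx1 mulmxA CgK subrr.
have BE : B *m Bg *m E = 0 by rewrite mulmxBr mulmx1 !mulmxA BgK subrr.
have FC : F *m (Cg *m C) = 0.
  by rewrite mulmxBl mul1mx -mulmxA (mulmxA C) CgK subrr.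
have EE : E *m E = E by rewrite {1}/E mulmxBl BE mul1mx subr0.
have FF : F *m F = F by rewrite {2}/F mulmxBr FC mulmx1 subr0.
(* Subtracting these terms leaves [E M F], which removes from [M] what the columns of [B] and the
   rows of [C] can absorb. *)
exists (Bg *m M), (E *m M *m Cg).
rewrite -(qrank_shift_block M B C (Bg *m M) (E *m M *m Cg)).
have -> : M - B *m (Bg *m M) - E *m M *m Cg *m C = E *m M *m F.
  by rewrite [RHS]mulmxBr mulmx1 [X in _ = X - _]mulmxBl mul1mx !mulmxA.
set N := E *m M *m F.
have EN : E *m N = N by rewrite /N !mulmxA EE.
have BN : B *m Bg *m N = 0 by rewrite -EN mulmxA BE mul0mx.
have NF : N *m F = N by rewrite -(mulmxA _ F) FF.
have NC : N *m (Cg *m C) = 0 by rewrite -NF -mulmxA FC mulmx0.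
apply: (@leq_trans (qrank (block_mx B 0 0 (block_mx N 0 0 C)))).
  rewrite addnAC addnC.
  apply: leq_trans (qrank_ublock_ge _ _ _); rewrite leq_add2l.
  exact: qrank_ublock_ge.
(* As [B Bg] kills [N] from the left and [Cg C] from the right, the multipliers split [[N B; C 0]]
   into diagonal blocks [B], [N], [C]. *)
have -> : block_mx B 0 0 (block_mx N 0 0 C) =
    block_mx (B *m Bg) 0 (col_mx E 0) (col_mx 0 1%:M) *m block_mx N B C 0
      *m block_mx 0 (row_mx F (Cg *m C)) 1%:M 0.
  rewrite !mulmx_block !mul_col_mx !(mulmx0, mul0mx, mulmx1, mul1mx).
  rewrite BN EN EB BgK !add_col_mx !(addr0, add0r) col_mx0 !mul0mx.
  by rewrite mul_col_row NF NC CF mulmxA CgK.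
exact: qrankMlr.
Qed.

Lemma qrank_one_sided_le M X Y :
  (qrank (M - B *m X - Y *m C)
     <= minn m (minn n (qrank (block_mx M B C 0))))%N.
Proof.
rewrite -(qrank_shift_block M B C X Y); move: (_ - _ - _) => N.
rewrite !leq_min qrank_block_ge -{1}[N]mul1mx qrank_mul_le.
by rewrite -[N]mulmx1 qrank_mul_le.
Qed.

Lemma qrank_one_sided_attains_max M : exists X Y,
  (minn m (minn n (qrank (block_mx M B C 0)))
     <= qrank (M - B *m X - Y *m C))%N.
Proof.
(* The one-sided terms are the two-sided updates [B X 1] and [1 Y C]; the identity factors make the
   other three block ranks at least [m] or [n]. *)
have [X [Y]] := qrank_two_update_attains_max B 1%:M 1%:M C M.
rewrite /two_update mulmx1 mul1mx => le; exists X, Y.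
apply: leq_trans le; rewrite /two_update_bound.
have gem p (D : 'M[H]_(m, p)) U : D *m U = 1%:M -> (m <= qrank D)%N.
  by move=> DU; apply: (@qrank_ge _ _ _ _ _ 1%:M U); rewrite mul1mx.
have row_m : (m <= qrank (row_mx M (row_mx B 1%:M)))%N.
  apply: (gem _ _ (col_mx 0 (col_mx 0 1%:M))).
  by rewrite !mul_row_col !mulmx0 !add0r mulmx1.
have col_n : (n <= qrank (col_mx M (col_mx 1%:M C)))%N.
  apply: (@qrank_ge _ _ _ _ _ (row_mx 0 (row_mx 1%:M 0)) 1%:M).
  by rewrite mulmx1 !mul_row_col !mul0mx mul1mx add0r addr0.
have block_m : (m <= qrank (block_mx M 1%:M 1%:M 0))%N.
  apply: (@qrank_ge _ _ _ _ _ (row_mx 1%:M 0) (col_mx 0 1%:M)).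
  by rewrite mul_row_block !mul0mx !addr0 !mul1mx mul_row_col mulmx0 mulmx1
    add0r.
rewrite !leq_min !geq_min row_m col_n block_m leqnn ?orbT //.
Qed.

End OneSided.

(** * Reduction of bordered matrices to two updates *)

Lemma qrank_bordered m n k l p q (A : 'M[H]_(m, n)) (B1 : 'M[H]_(m, k))
    (C2 : 'M[H]_(l, n)) (B : 'M[H]_(m, p)) (C : 'M[H]_(q, n)) :
  qrank (block_mx (block_mx A B1 C2 0) (col_mx B 0) (row_mx C 0) 0) =
  qrank (block_mx A (row_mx B1 B) (col_mx C2 C) 0).
Proof.
by rewrite -[in RHS](block_mx0) block_mxA qrank_castmx.
Qed.

Lemma qrank_bordered_row m n k l p (A : 'M[H]_(m, n)) (B1 : 'M[H]_(m, k))
    (C2 : 'M[H]_(l, n)) (B : 'M[H]_(m, p)) :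
  qrank (row_mx (block_mx A B1 C2 0) (col_mx B 0)) =
  qrank (block_mx A (row_mx B1 B) C2 0).
Proof.
have E : col_mx (row_mx B1 B) 0 =
    row_mx (col_mx B1 0) (col_mx B 0) :> 'M_(m + l, _).
  by rewrite -block_mxEh block_mxEv row_mx0.
by rewrite [in RHS]block_mxEh E row_mxA qrank_castmx -block_mxEh.
Qed.

Lemma qrank_bordered_col m n k l q (A : 'M[H]_(m, n)) (B1 : 'M[H]_(m, k))
    (C2 : 'M[H]_(l, n)) (C : 'M[H]_(q, n)) :
  qrank (col_mx (block_mx A B1 C2 0) (row_mx C 0)) =
  qrank (block_mx A B1 (col_mx C2 C) 0).
Proof.
have E : row_mx (col_mx C2 C) 0 =
    col_mx (row_mx C2 0) (row_mx C 0) :> 'M_(_, n + k).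
  by rewrite -block_mxEv block_mxEh col_mx0.
by rewrite [in RHS]block_mxEv E col_mxA qrank_castmx -block_mxEv.
Qed.

Lemma row_mx_col_mx0 m l p q (B : 'M[H]_(m, p)) (B' : 'M[H]_(m, q)) :
  row_mx (col_mx B 0) (col_mx B' 0) = col_mx (row_mx B B') 0 :> 'M_(m + l, _).
Proof. by rewrite -block_mxEh block_mxEv row_mx0. Qed.

Lemma col_mx_row_mx0 n k p q (C : 'M[H]_(p, n)) (C' : 'M[H]_(q, n)) :
  col_mx (row_mx C 0) (row_mx C' 0) = row_mx (col_mx C C') 0 :> 'M_(_, n + k).
Proof. by rewrite -block_mxEv block_mxEh col_mx0. Qed.

(** Zero padding confines the updates to the corner of the bordered matrix, so the results on two
    updates apply to it directly. *)
Lemma two_update_bordered m n k l p3 q3 p4 q4 (A : 'M[H]_(m, n))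
    (B1 : 'M[H]_(m, k)) (C2 : 'M[H]_(l, n))
    (B3 : 'M[H]_(m, p3)) (C3 : 'M[H]_(q3, n))
    (B4 : 'M[H]_(m, p4)) (C4 : 'M[H]_(q4, n)) X Y :
  two_update (col_mx B3 0) (row_mx C3 0) (col_mx B4 0) (row_mx C4 0)
    (block_mx A B1 C2 0) X Y =
  block_mx (two_update B3 C3 B4 C4 A X Y) B1 C2 0.
Proof.
rewrite /two_update !mul_col_mx !mul_mx_row !mul0mx !mulmx0 -!block_mxEv.
by rewrite !opp_block_mx !add_block_mx !oppr0 !addr0.
Qed.

End BorderedMatrices.

(** * Extremal ranks of the full expression *)

Lemma PoszMin (a b : nat) : Num.min a%:Z b%:Z = (minn a b)%:Z.
Proof. by rewrite /Num.min /minn ltz_nat; case: ltnP. Qed.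

Theorem theorem3p4 (R : realType) (m n k l k3 l3 k4 l4 : nat)
    (A : 'M[quaternion R]_(m, n))
    (B1 : 'M[quaternion R]_(m, k)) (C2 : 'M[quaternion R]_(l, n))
    (B3 : 'M[quaternion R]_(m, k3)) (C3 : 'M[quaternion R]_(l3, n))
    (B4 : 'M[quaternion R]_(m, k4)) (C4 : 'M[quaternion R]_(l4, n)) :
  let f2 (X1 : 'M[quaternion R]_(k, n)) (X2 : 'M[quaternion R]_(m, l))
         (X3 : 'M[quaternion R]_(k3, l3)) (X4 : 'M[quaternion R]_(k4, l4)) :=
    A - B1 *m X1 - X2 *m C2 - B3 *m X3 *m C3 - B4 *m X4 *m C4 in
  let r p q (M : 'M[quaternion R]_(p, q)) : int := (qrank M)%:Z in
  let ranks : set int :=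
    [set z | exists X1 X2 X3 X4, z = r _ _ (f2 X1 X2 X3 X4)] in
  let rA_B1_C234 :=
    r _ _ (block_mx A B1 (col_mx C2 (col_mx C3 C4)) 0) in
  let rA_B134_C2 :=
    r _ _ (block_mx A (row_mx B1 (row_mx B3 B4)) C2 0) in
  let rA_B13_C24 :=
    r _ _ (block_mx A (row_mx B1 B3) (col_mx C2 C4) 0) in
  let rA_B14_C23 :=
    r _ _ (block_mx A (row_mx B1 B4) (col_mx C2 C3) 0) in
  let s1 :=
    rA_B13_C24
    - r _ _ (block_mx A (row_mx B1 (row_mx B3 B4)) (col_mx C2 C4) 0)
    - r _ _ (block_mx A (row_mx B1 B3) (col_mx C2 (col_mx C3 C4)) 0) in
  let s2 :=
    rA_B14_C23
    - r _ _ (block_mx A (row_mx B1 (row_mx B3 B4)) (col_mx C2 C3) 0)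
    - r _ _ (block_mx A (row_mx B1 B4) (col_mx C2 (col_mx C3 C4)) 0) in
  is_maximum ranks
    (Num.min m%:Z (Num.min n%:Z (Num.min rA_B1_C234 (Num.min rA_B134_C2
      (Num.min rA_B13_C24 rA_B14_C23)))))
  /\
  is_minimum ranks
    (rA_B1_C234 + rA_B134_C2 - r _ _ B1 - r _ _ C2 + Num.max s1 s2).
Proof.
move=> f2 r ranks rA_B1_C234 rA_B134_C2 rA_B13_C24 rA_B14_C23 s1 s2.
(* [U] collects the two-sided terms. The extremal ranks over [X1] and [X2] depend on it only through
   the rank of its bordered matrix [V]. *)
pose U := two_update B3 C3 B4 C4 A; pose V X3 X4 := block_mx (U X3 X4) B1 C2 0.
have f2E X1 X2 X3 X4 : f2 X1 X2 X3 X4 = U X3 X4 - B1 *m X1 - X2 *m C2.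
  rewrite /f2 /U /two_update; move: (B1 *m X1) (X2 *m C2) => a b.
  move: (B3 *m X3 *m C3) (B4 *m X4 *m C4) => c d.
  rewrite (addrAC _ (- b) (- c)) (addrAC A (- a) (- c)).
  by rewrite (addrAC _ (- b) (- d)) (addrAC _ (- a) (- d)).
have VE X3 X4 : V X3 X4 = two_update (col_mx B3 0) (row_mx C3 0) (col_mx B4 0)
    (row_mx C4 0) (block_mx A B1 C2 0) X3 X4 by rewrite two_update_bordered.
have boundE : two_update_bound (col_mx B3 0) (row_mx C3 0) (col_mx B4 0)
      (row_mx C4 0) (block_mx A B1 C2 0) =
    minn (minn (qrank (block_mx A B1 (col_mx C2 (col_mx C3 C4)) 0))
               (qrank (block_mx A (row_mx B1 (row_mx B3 B4)) C2 0)))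
         (minn (qrank (block_mx A (row_mx B1 B3) (col_mx C2 C4) 0))
               (qrank (block_mx A (row_mx B1 B4) (col_mx C2 C3) 0))).
  rewrite /two_update_bound row_mx_col_mx0 col_mx_row_mx0.
  by rewrite qrank_bordered_row qrank_bordered_col !qrank_bordered.
split; split.
(* [X3] and [X4] are chosen first, to maximize [r(V)]; then [X1] and [X2] for the resulting
   matrix. *)
- have [X3 [X4 leV]] := qrank_two_update_attains_max (col_mx B3 0) (row_mx C3 0)
    (col_mx B4 0) (row_mx C4 0) (block_mx A B1 C2 0).
  rewrite boundE -VE in leV.
  have [X1 [X2 lef]] := qrank_one_sided_attains_max B1 C2 (U X3 X4).
  exists X1, X2, X3, X4.
  have := qrank_one_sided_le B1 C2 (U X3 X4) X1 X2.
  have := qrank_two_update_le (col_mx B3 0) (row_mx C3 0)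
    (col_mx B4 0) (row_mx C4 0) (block_mx A B1 C2 0) X3 X4.
  rewrite boundE -VE => leV'.
  rewrite -f2E in lef *; move: leV leV' lef => leV leV' lef lef'.
  rewrite !PoszMin; congr Posz; rewrite -/(V X3 X4) in lef lef'; lia.
- move=> _ [X1 [X2 [X3 [X4 ->]]]].
  have := qrank_two_update_le (col_mx B3 0) (row_mx C3 0)
    (col_mx B4 0) (row_mx C4 0) (block_mx A B1 C2 0) X3 X4.
  rewrite boundE -VE => leV'.
  have := qrank_one_sided_le B1 C2 (U X3 X4) X1 X2.
  rewrite -f2E -/(V X3 X4) !PoszMin lez_nat; lia.
- have [X3 [X4 gapV]] := qrank_two_update_attains_min (col_mx B3 0)
    (row_mx C3 0) (col_mx B4 0) (row_mx C4 0) (block_mx A B1 C2 0).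
  have [X1 [X2 lef]] := qrank_one_sided_attains_min B1 C2 (U X3 X4).
  exists X1, X2, X3, X4.
  have gef := qrank_one_sided_ge B1 C2 (U X3 X4) X1 X2.
  have := qrank_two_update_ge34 (col_mx B3 0) (row_mx C3 0)
    (col_mx B4 0) (row_mx C4 0) (block_mx A B1 C2 0) X3 X4.
  have := qrank_two_update_ge43 (col_mx B3 0) (row_mx C3 0)
    (col_mx B4 0) (row_mx C4 0) (block_mx A B1 C2 0) X3 X4.
  move: gapV; rewrite /gap34 /gap43 -VE row_mx_col_mx0 col_mx_row_mx0.
  rewrite qrank_bordered_row qrank_bordered_col !qrank_bordered.
  rewrite -f2E -/(V X3 X4) in lef gef *.
  rewrite /s1 /s2 /rA_B1_C234 /rA_B134_C2 /rA_B13_C24 /rA_B14_C23 /r.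
  (* Both lower bounds on [r(V)] hold and one is reached, so [r(V)] is the larger; this is the
     origin of the maximum of [s1] and [s2]. *)
  by case: leP => ? gapV ge43 ge34; case: gapV; lia.
move=> _ [X1 [X2 [X3 [X4 ->]]]].
have := qrank_one_sided_ge B1 C2 (U X3 X4) X1 X2.
have := qrank_two_update_ge34 (col_mx B3 0) (row_mx C3 0)
  (col_mx B4 0) (row_mx C4 0) (block_mx A B1 C2 0) X3 X4.
have := qrank_two_update_ge43 (col_mx B3 0) (row_mx C3 0)
  (col_mx B4 0) (row_mx C4 0) (block_mx A B1 C2 0) X3 X4.
rewrite -VE row_mx_col_mx0 col_mx_row_mx0.
rewrite qrank_bordered_row qrank_bordered_col !qrank_bordered -f2E -/(V X3 X4).
rewrite /s1 /s2 /rA_B1_C234 /rA_B134_C2 /rA_B13_C24 /rA_B14_C23 /r.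
by case: leP; lia.
Qed.
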